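(* Let $n\ge1$ and let $\mathbb{S}=\mathbb{S}_{1,n}$ be the spin factor. For $k$ odd, $\langle\operatorname{Tr}\mathbf{x}^k\rangle_{\mathbb{S}}=0$. For $k$ even, $$\langle\operatorname{Tr}\mathbf{x}^k\rangle_{\mathbb{S}}=\sum_{\beta}\sum_{\pi}n^{N(\pi)},$$ where $\beta$ ranges over all barbell structures on $\{1,\dots,k\}$ and $\pi$ ranges over all pairings of $\beta$.
   Context: **Spin factor.** $\mathbb{S}_{1,n}$ is the real vector space $\mathbb{R}\times\mathbb{R}^n$, with elements $\mathbf{x}=(x_0,x)$, and product $\mathbf{x}\bullet\mathbf{y}=(x_0y_0+x\cdot y,\;x_0y+y_0x)$, where $\cdot$ is the Euclidean dot product. The trace is $\operatorname{Tr}(\mathbf{x})=x_0$. Powers: $\mathbf{x}^1=\mathbf{x}$, $\mathbf{x}^k=\mathbf{x}\bullet\mathbf{x}^{k-1}$ for $k>1$. For a polynomial function $h$ on $\mathbb{S}$, $\langle h\rangle_{\mathbb{S}}=\int_{\mathbb{S}}h(\mathbf{x})e^{-\operatorname{Tr}(\mathbf{x}^2)/2}d\mathbf{x}\Big/\int_{\mathbb{S}}e^{-\operatorname{Tr}(\mathbf{x}^2)/2}d\mathbf{x}$, with Lebesgue measure. **Barbell structures.** Let $k$ be even. A barbell structure $\beta$ on $S=\{1,\dots,k\}$ is determined by an ordered partition $S=S_0\sqcup S_b$ into two (possibly empty) subsets of even order. The points of $S_b$ are ordered by label, and consecutive ones are joined in disjoint pairs by edges called barbells (first with second, third with fourth,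 and so on), giving $|S_b|/2$ barbells. A pairing $\pi$ of $\beta$ consists of a partition of $S_0$ into 2-element subsets and a partition of $S_b$ into 2-element subsets (the empty set has exactly one such partition). $N(\pi)$ is the number of connected components of the (multi)graph with vertex set $S_b$ whose edges are the barbells and the pairs of $\pi$ in $S_b$. *)

(* Defs.v *)
From HB Require Import structures.
From mathcomp Require Import all_boot all_order all_algebra.

Set Implicit Arguments.
Unset Strict Implicit.
Unset Printing Implicit Defensive.

(* Must precede the import of all_classical, which shadows setT, partition and
   the set comprehension notations of finset. *)
Section barbell.
Variable k : nat.
Implicit Types (A : {set 'I_k}) (beta : {set 'I_k} * {set 'I_k})
  (pi : {set {set 'I_k}} * {set {set 'I_k}}).

(* beta = (S_0, S_b); the label j in {1, ..., k} is the ordinal j - 1. *)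
Definition barbell_structure beta : bool :=
  [&& beta.1 :|: beta.2 == [set: 'I_k], [disjoint beta.1 & beta.2],
      ~~ odd #|beta.1| & ~~ odd #|beta.2|].

(* enum A lists A by increasing label. *)
Definition barbells A : {set {set 'I_k}} :=
  [set [set x; y] | x in A, y in A
    & ~~ odd (index x (enum A)) && (index y (enum A) == (index x (enum A)).+1)].

Definition pair_partition A (P : {set {set 'I_k}}) : bool :=
  partition P A && [forall B in P, #|B| == 2].

Definition barbell_pairing beta pi : bool :=
  pair_partition beta.1 pi.1 && pair_partition beta.2 pi.2.

Definition barbell_edge beta pi : rel 'I_k :=
  fun x y => [set x; y] \in barbells beta.2 :|: pi.2.

Definition barbell_ncomp beta pi : nat := n_comp (barbell_edge beta pi) beta.2.

End barbell.

From mathcomp Require Import all_classical all_reals all_analysis.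

Import Order.TTheory GRing.Theory Num.Theory.

Local Open Scope classical_set_scope.
Local Open Scope ring_scope.

Section lebesgue_tuple.
Context {R : realType}.
Local Notation mR := (measurableTypeR R).

Definition tuple_cons n (z : mR * n.-tuple mR) : n.+1.-tuple mR :=
  [tuple of z.1 :: z.2].

(* The n-fold product of the one-dimensional Lebesgue measure, transported
   along R * R^n ~ R^(n+1); see lebesgue_tuple_box. *)
Fixpoint lebesgue_tuple n : set (n.-tuple mR) -> \bar R :=
  if n is n'.+1 then
    pushforward (@lebesgue_measure R \x @lebesgue_tuple n')%E (@tuple_cons n')
  else dirac [tuple].

Let tuple_uncons n (t : n.+1.-tuple mR) : mR * n.-tuple mR :=
  (thead t, [tuple of behead t]).

Let tuple_consK n : cancel (@tuple_cons n) (@tuple_uncons n).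
Proof.
by case=> a t; rewrite /tuple_uncons theadE; congr pair; exact: val_inj.
Qed.

Let measurable_tuple_cons n : measurable_fun setT (@tuple_cons n).
Proof. exact: measurable_cons. Qed.

Let measurable_tuple_uncons n : measurable_fun setT (@tuple_uncons n).
Proof.
apply/measurable_fun_pairP; split; first exact: (measurable_tnth ord0).
exact: measurable_behead.
Qed.

Let sigma_finite_tuple_cons n
    (m : {sigma_finite_measure set (n.-tuple mR) -> \bar R}) :
  {m' : {sigma_finite_measure set (n.+1.-tuple mR) -> \bar R} |
    m' = pushforward (@lebesgue_measure R \x m)%E (@tuple_cons n) :> (_ -> _)}.
Proof.
pose mu := Measure.clone _ _ _ (@lebesgue_measure R \x m)%E _.
have [nu nuE] : {nu : set (n.+1.-tuple mR) -> \bar R |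
    nu = pushforward mu (@tuple_cons n)} by exists (pushforward mu (@tuple_cons n)).
have nu0 : nu set0 = 0%E by rewrite nuE /pushforward preimage_set0 measure0.
have nu_ge0 A : (0 <= nu A)%E by rewrite nuE; exact: (measure_ge0 mu).
have nu_sigma_additive : semi_sigma_additive nu.
  have mcons (A : set (n.+1.-tuple mR)) : measurable A ->
      measurable (@tuple_cons n @^-1` A).
    by move=> mA; rewrite -[X in measurable X]setTI;
      exact: measurable_tuple_cons.
  move=> F mF tF mUF; rewrite nuE /pushforward preimage_bigcup.
  apply: measure_semi_sigma_additive; first by move=> i; exact: mcons.
  - apply/trivIsetP => i j _ _ ij; rewrite -preimage_setI.
    by move/trivIsetP : tF => /(_ _ _ _ _ ij) ->//; rewrite preimage_set0.
  - by rewrite -preimage_bigcup; exact: mcons.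
have nu_sigma_finite : sigma_finite setT nu.
  have /sigma_finiteP[F [TF ndF Foo]] := sigma_finiteT (@lebesgue_measure R).
  have /sigma_finiteP[G [TG ndG Goo]] := sigma_finiteT m.
  exists (fun i => @tuple_uncons n @^-1` (F i `*` G i)).
    rewrite -preimage_bigcup (_ : \bigcup_i _ = setT) ?preimage_setT//.
    apply/seteqP; split => // -[x y] _.
    have [i _ Fx] : (\bigcup_i F i) x by rewrite -TF.
    have [j _ Gy] : (\bigcup_i G i) y by rewrite -TG.
    exists (maxn i j) => //; split.
    - by move: x Fx; exact/subsetPset/ndF/leq_maxl.
    - by move: y Gy; exact/subsetPset/ndG/leq_maxr.
  move=> i; have [mF Foo'] := Foo i; have [mG Goo'] := Goo i; split.
    rewrite -[X in measurable X]setTI; apply: measurable_tuple_uncons => //.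
    exact: measurableX.
  rewrite nuE /pushforward -comp_preimage (_ : _ @^-1` _ = F i `*` G i).
    by rewrite /= product_measure1E// lte_mul_pinfty// ge0_fin_numE.
  by apply/seteqP; split => z; rewrite /preimage /mkset /comp tuple_consK.
pose M := isMeasure.Build _ _ _ nu nu0 nu_ge0 nu_sigma_additive.
pose nuM : {measure set _ -> \bar R} := HB.pack nu M.
pose S := Measure_isSigmaFinite.Build _ _ _ nuM nu_sigma_finite.
pose nuS : {sigma_finite_measure set _ -> \bar R} := HB.pack nu M S.
by exists nuS; exact: nuE.
Qed.

Lemma lebesgue_tuple_subproof n :
  {mu : {sigma_finite_measure set (n.-tuple mR) -> \bar R} |
    mu = @lebesgue_tuple n :> (_ -> _)}.
Proof.
elim: n => [|n [mu muE]] /=; first by exists (dirac [tuple]).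
by rewrite -muE; exact: sigma_finite_tuple_cons.
Qed.

Section instances.
Variable n : nat.
Let mu := sval (@lebesgue_tuple_subproof n).
Let muE : mu = @lebesgue_tuple n :> (_ -> _).
Proof. exact: (svalP (lebesgue_tuple_subproof n)). Qed.

Let lebesgue_tuple0 : @lebesgue_tuple n set0 = 0%E.
Proof. by rewrite -muE measure0. Qed.

Let lebesgue_tuple_ge0 A : (0 <= @lebesgue_tuple n A)%E.
Proof. by rewrite -muE. Qed.

Let lebesgue_tuple_sigma_additive : semi_sigma_additive (@lebesgue_tuple n).
Proof. by rewrite -muE; exact: measure_semi_sigma_additive. Qed.

HB.instance Definition _ := isMeasure.Build _ _ _ (@lebesgue_tuple n)
  lebesgue_tuple0 lebesgue_tuple_ge0 lebesgue_tuple_sigma_additive.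

Let lebesgue_tuple_sigma_finite : sigma_finite setT (@lebesgue_tuple n).
Proof. by rewrite -muE; exact: sigma_finiteT. Qed.

HB.instance Definition _ := Measure_isSigmaFinite.Build _ _ _
  (@lebesgue_tuple n) lebesgue_tuple_sigma_finite.

End instances.

Lemma lebesgue_tuple_box n (A : 'I_n -> set mR) :
  (forall i, measurable (A i)) ->
  lebesgue_tuple [set t : n.-tuple mR | forall i, A i (tnth t i)] =
  (\prod_(i < n) lebesgue_measure (A i))%E.
Proof.
elim: n A => [A _|n IHn A mA].
  by rewrite big_ord0 /= diracE mem_set// => -[].
rewrite big_ord_recl -IHn//= /pushforward -product_measure1E//; last first.
  rewrite (_ : [set _ | _] =
      \bigcap_(i in [set: 'I_n]) ((@tnth _ mR ^~ i) @^-1` A (lift ord0 i))).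
    apply: fin_bigcap_measurable => // i _.
    by rewrite -[X in measurable X]setTI; exact: measurable_tnth.
  by apply/seteqP; split => [t At i _|t At i]; exact: At.
congr product_measure1; apply/seteqP; split => [[a t] At|[a t] [/= Aa At] i] /=.
  by split => [|i]; [have := At ord0|have := At (lift ord0 i); rewrite tnthS].
by case: (unliftP ord0 i) => [j|] ->; rewrite ?tnthS ?tnth0//; exact: At.
Qed.

End lebesgue_tuple.

Section spin_factor.
Context {R : realType} {n : nat}.
Local Notation mR := (measurableTypeR R).
Local Notation spin := (mR * n.-tuple mR)%type.

Definition dotp (x y : n.-tuple mR) : R :=
  \sum_(i < n) (tnth x i : R) * (tnth y i : R).

Definition spin_mul (x y : spin) : spin :=
  ((x.1 : R) * (y.1 : R) + dotp x.2 y.2,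
   [tuple (x.1 : R) * (tnth y.2 i : R) + (y.1 : R) * (tnth x.2 i : R) | i < n]).

Definition spin_one : spin := (1 : R, [tuple (0 : R) | i < n]).

(* spin_exp x 1 = x and spin_exp x k.+2 = spin_mul x (spin_exp x k.+1);
   spin_exp x 0 is the unit spin_one. *)
Definition spin_exp (x : spin) (k : nat) : spin := iterop k spin_mul x spin_one.

Definition spin_tr (x : spin) : R := x.1.

Definition spin_measure : set spin -> \bar R :=
  (@lebesgue_measure R \x @lebesgue_tuple R n)%E.

HB.instance Definition _ := Measure.on spin_measure.

Definition spin_weight (x : spin) : R := expR (- (spin_tr (spin_exp x 2) / 2)).

(* Extended-real valued, so that a finite value of the mean requires the
   numerator to be a finite integral. *)
Definition spin_mean (h : spin -> R) : \bar R :=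
  ((\int[spin_measure]_x (h x * spin_weight x)%:E) /
   (\int[spin_measure]_x (spin_weight x)%:E))%E.

End spin_factor.

(* Main.v *)
(* Both sides equal a sum over the subsets A of {1, ..., k} of even size and
   the colourings d of the #|A|/2 barbells of A by {1, ..., n}, with weights
   products of numbers of matchings.
   Combinatorial side: n^N counts the colourings of S_b by n colours that are
   constant along the edges, so after exchanging sums one counts the pairings
   with monochromatic pairs, which are products of matchings of the colour
   classes.
   Analytic side: Tr x^k = ((x_0 + |x|)^k + (x_0 - |x|)^k) / 2 is the sum of
   x_0^(k - #|A|) |x|^#|A| over A of even size; expanding |x|^(2m) =
   (sum_i x_i^2)^m over maps d from the m factors to {1, ..., n} leaves
   monomials, whose Gaussian means are products of numbers of matchings. *)
Require Import Defs.
From mathcomp Require Import all_boot all_order all_algebra.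
From mathcomp Require Import zify ring lra.

Set Implicit Arguments.
Unset Strict Implicit.
Unset Printing Implicit Defensive.

(* Perfect matchings of m points; equally the m-th moment of a standard Gaussian. *)
Fixpoint matchings (m : nat) : nat :=
  match m with
  | 0 => 1
  | 1 => 0
  | (m'.+1 as p).+1 => p * matchings m'
  end.

Lemma matchingsS m : matchings m.+1 = m * matchings m.-1.
Proof. by case: m. Qed.

Lemma matchings_odd m : odd m -> matchings m = 0.
Proof.
elim/ltn_ind: m => -[|[|m]] // IH /=; rewrite negbK => om.
by rewrite IH ?muln0.
Qed.

Definition fiber (T V : finType) (f : T -> V) (v : V) : {set T} :=
  [set x | f x == v].

Lemma in_fiber (T V : finType) (f : T -> V) v x : (x \in fiber f v) = (f x == v).
Proof. by rewrite inE. Qed.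

(** * Counting pair partitions whose pairs are monochromatic *)

Section monochromatic.
Variables (k : nat) (V : finType).
Implicit Types (A B : {set 'I_k}) (P E : {set {set 'I_k}}).

Definition mono (c : 'I_k -> V) E :=
  [forall B in E, forall x in B, forall y in B, c x == c y].

Lemma monoP c E :
  reflect (forall B x y, B \in E -> x \in B -> y \in B -> c x = c y) (mono c E).
Proof.
apply: (iffP 'forall_implyP) => [h B x y BE xB yB|h B BE].
  by have /'forall_implyP/(_ x xB)/'forall_implyP/(_ y yB)/eqP := h B BE.
by apply/'forall_implyP => x xB; apply/'forall_implyP => y yB; apply/eqP/(h B).
Qed.

Lemma monoU c E1 E2 : mono c (E1 :|: E2) = mono c E1 && mono c E2.
Proof.
apply/monoP/andP => [h|[/monoP h1 /monoP h2] B x y].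
  by split; apply/monoP => B x y BE; apply: (h B); rewrite inE BE ?orbT.
by rewrite inE => /orP[/h1|/h2]; apply.
Qed.

Lemma mono1 c x y : mono c [set [set x; y]] = (c x == c y).
Proof.
apply/monoP/eqP => [h|cxy B u v].
  by apply: (h [set x; y]); rewrite !inE eqxx ?orbT.
by rewrite inE => /eqP ->; rewrite !inE => /orP[]/eqP-> /orP[]/eqP->.
Qed.

Lemma pair_partition0 P : pair_partition set0 P = (P == set0).
Proof.
rewrite /pair_partition partition_set0; case: eqP => //= ->.
by apply/'forall_implyP => B; rewrite inE.
Qed.

Lemma pair_partitionU1 A P x y : x != y -> x \in A -> y \in A ->
  [set x; y] \notin P ->
  pair_partition A ([set x; y] |: P) = pair_partition (A :\: [set x; y]) P.
Proof.
move=> xy xA yA BP; set B := [set x; y].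
have BA : B \subset A by apply/subsetP => z; rewrite !inE => /orP[]/eqP->.
have B0 : B != set0 by apply/set0Pn; exists x; rewrite !inE eqxx.
apply/andP/andP => -[pP /'forall_implyP hP]; split.
- by rewrite -(setU1K BP); apply: partitionD1 => //; rewrite setU11.
- by apply/'forall_implyP => C CP; apply: hP; rewrite inE CP orbT.
- have -> : A = B :|: A :\: B.
    by rewrite setDE setUIr setUCr setIT; apply/esym/setUidPr.
  by apply: partitionU1 => //; rewrite disjoints_subset setCD subsetUr.
- apply/'forall_implyP => C /setU1P[->|/hP //].
  by rewrite cards2 xy.
Qed.

Lemma pair_partition_partner A P x : pair_partition A P -> x \in A ->
  exists y, [/\ y \in A, y != x & pblock P x = [set x; y]].
Proof.
move=> /andP[pP /'forall_implyP hP] xA.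
have xc : x \in cover P by rewrite (cover_partition pP).
have xB : x \in pblock P x by rewrite mem_pblock.
have BP := pblock_mem xc; have /cards2P[u [v [uv Buv]]] := hP _ BP.
have sBA := subsetP (partitionS pP BP).
move: xB; rewrite Buv !inE => /orP[]/eqP->; [exists v|exists u]; split=> //.
- by apply: sBA; rewrite Buv !inE eqxx orbT.
- by rewrite eq_sym.
- by apply: sBA; rewrite Buv !inE eqxx.
- by rewrite setUC.
Qed.

(** Classify by the partner [y] of [x], which must have the colour of [x]; deleting that pair is a
    bijection onto the monochromatic pair partitions of the remaining points. *)
Lemma sum_mono_partition_rec (c : 'I_k -> V) A x : x \in A ->
  \sum_(P | pair_partition A P && mono c P) 1 =
  \sum_(y in A :\ x | c x == c y)
    \sum_(P | pair_partition (A :\: [set x; y]) P && mono c P) 1.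
Proof.
(* [p P] is the partner of [x] in [P]; the default [x] never occurs for a pair partition of [A]. *)
move=> xA; pose p P := odflt x [pick y in pblock P x :\ x].
have pE A' P y : pair_partition A' P -> y != x ->
    [set x; y] \in P -> p P = y.
  move=> /andP[/partition_trivIset tP _] yx BP.
  rewrite /p (def_pblock tP BP) ?set21 //.
  case: pickP => [z|/(_ y)]; last by rewrite !inE yx eqxx orbT.
  by rewrite !inE => /andP[/negbTE ->]/eqP.
have pP P : pair_partition A P -> [/\ p P \in A, p P != x & [set x; p P] \in P].
  move=> ppP; have [y [yA yx By]] := pair_partition_partner ppP xA.
  have BP : [set x; y] \in P.
    by rewrite -By pblock_mem // (cover_partition (andP ppP).1).
  by rewrite (pE A P y).
rewrite (partition_big p [pred y | (y \in A :\ x) && (c x == c y)]) /=; last first.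
  move=> P /andP[/pP[pA px xpP] /monoP mP]; rewrite !inE px pA /=.
  by apply/eqP/(mP _ _ _ xpP); rewrite !inE eqxx ?orbT.
apply: eq_bigr => y /andP[]; rewrite !inE => /andP[yx yA] cxy.
set B := [set x; y].
rewrite (reindex_onto (fun P => B |: P) (fun P => P :\ B)) /=; last first.
  by move=> P /andP[/andP[/pP[_ _ xpP] _] /eqP pPy]; rewrite setD1K // /B -pPy.
(* If [B] is already in [P], both conditions fail: inserting and deleting [B] does not give back
   [P], and [B] is not contained in [A :\: B]. *)
apply: eq_bigl => P; have [BP|BP] := boolP (B \in P).
  rewrite [RHS](_ : _ = false); last first.
    apply/negP => /andP[/andP[/partitionS/(_ BP)/subsetP/(_ x)]].
    by rewrite !inE eqxx /= => /(_ isT).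
  apply/negP => /andP[_ /eqP]/setP/(_ B).
  by rewrite BP !inE eqxx.
rewrite setU1K // eqxx andbT pair_partitionU1 // 1?eq_sym // monoU mono1 cxy /=.
have [ppP|//] := boolP (pair_partition _ P).
have ppBP : pair_partition A (B |: P) by rewrite pair_partitionU1 // eq_sym.
by rewrite (pE A _ y) ?setU11 ?eqxx ?andbT.
Qed.

(** Pairs stay inside colour classes. The induction on the size of [A] follows the recurrence of
    [matchings]: a point in a class of size [a] has [a.-1] possible partners. *)
Lemma sum_mono_partition (c : 'I_k -> V) A :
  \sum_(P | pair_partition A P && mono c P) 1 =
  \prod_v matchings #|[set x in A | c x == v]|.
Proof.
have [m] := ubnP #|A|; elim: m A => // m IH A; rewrite ltnS => Am.
have [->|/set0Pn[x xA]] := eqVneq A set0.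
  rewrite (big_pred1 set0) => [|P]; last first.
    rewrite pair_partition0 andb_idr // => /eqP ->.
    by apply/monoP => B ? ?; rewrite inE.
  by rewrite big1 // => v _; rewrite (_ : [set _ in _ | _] = set0) ?cards0 //;
    apply/setP => z; rewrite !inE.
rewrite (sum_mono_partition_rec c xA) [RHS](bigD1 (c x)) //=.
pose rest := \prod_(v | v != c x) matchings #|[set z in A | c z == v]|.
set a := #|[set z in A | c z == c x]|.
have aE : a = #|[set z in A :\ x | c x == c z]|.+1.
  rewrite /a (cardsD1 x) inE xA eqxx add1n; congr _.+1; apply: eq_card => z.
  by rewrite !inE andbA [c z == _]eq_sym.
(* Removing [x] and its partner shrinks the class of [c x] by two and leaves the other classes,
   collected in [rest], unchanged. *)
transitivity (\sum_(y in A :\ x | c x == c y) matchings a.-2 * rest).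
  apply: eq_bigr => y /andP[]; rewrite !inE => /andP[yx yA] /eqP cxy.
  rewrite IH; last first.
    apply: leq_trans Am; apply: proper_card; apply/properP; split.
      exact: subsetDl.
    by exists x => //; rewrite !inE eqxx.
  rewrite (bigD1 (c x)) //=; congr (matchings _ * _).
    rewrite /a [in RHS](cardsD1 x) [in RHS](cardsD1 y (_ :\ x)).
    rewrite !inE xA yA yx cxy !eqxx /=.
    by apply: eq_card => z; rewrite !inE; case: (z == x); case: (z == y).
  apply: eq_bigr => v vx; congr matchings; apply: eq_card => z; rewrite !inE.
  case: eqVneq => [->|_] /=; first by rewrite [c x == v]eq_sym (negbTE vx) !andbF.
  by case: eqVneq => [->|//] /=; rewrite -cxy [c x == v]eq_sym (negbTE vx) !andbF.
rewrite sum_nat_const mulnA; congr (_ * _); rewrite aE matchingsS /=.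
by congr (_ * _); apply: eq_card => z; rewrite !inE [LHS]unfold_in !inE.
Qed.

End monochromatic.

(** * Parity of complements, unrestricted matchings, and colourings constant on graph components *)

Lemma odd_cardsC k (A : {set 'I_k}) : odd #|~: A| = odd k (+) odd #|A|.
Proof.
by have := congr1 odd (cardsC A); rewrite card_ord oddD => <-; rewrite addbC addKb.
Qed.

(** With a single colour every pair is monochromatic. *)
Lemma sum_pair_partition k (A : {set 'I_k}) :
  \sum_(P | pair_partition A P) 1 = matchings #|A|.
Proof.
have := sum_mono_partition (fun=> tt) A; rewrite (big_pred1 tt); last by case.
rewrite [RHS](_ : _ = matchings #|A|); last first.
  by congr matchings; apply: eq_card => x; rewrite !inE andbT.
move=> <-; apply: eq_bigl => P; rewrite [mono _ _](_ : _ = true) ?andbT //.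
by apply/monoP.
Qed.

(* Functions on [U] correspond, by composition with the partial surjection [q],
   to the functions on [T] that are constant on the fibres of [q] and take the
   junk value [v0] off its domain. *)
Lemma sum_ffun_factor (T U V : finType) (v0 : V) (q : T -> option U) (s : U -> T)
    (F : {ffun T -> V} -> nat) : (forall u, q (s u) = Some u) ->
  \sum_(c : {ffun T -> V} | [forall x, c x == oapp (c \o s) v0 (q x)]) F c =
  \sum_(d : {ffun U -> V}) F [ffun x => oapp d v0 (q x)].
Proof.
move=> qs; pose h (d : {ffun U -> V}) : {ffun T -> V} := [ffun x => oapp d v0 (q x)].
pose h' (c : {ffun T -> V}) : {ffun U -> V} := [ffun u => c (s u)].
rewrite (reindex_onto h h') => [|c /forallP hc]; last first.
  apply/ffunP => x; rewrite ffunE (eqP (hc x)).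
  by case: (q x) => //= u; rewrite ffunE.
apply: eq_bigl => d; apply/andP; split.
  by apply/forallP => x; rewrite ffunE; case: (q x) => //= u; rewrite ffunE qs.
by apply/eqP/ffunP => u; rewrite !ffunE qs.
Qed.

(** A function constant along edges amounts to a free choice of value at the root of each component.
    Since [A] is closed, a component lies inside [A] or avoids it, and off [A] the value is forced
    to be [v0]. *)
Lemma sum_ffun_connect (T V : finType) (v0 : V) (e : rel T) (A : {set T}) :
  symmetric e -> closed e A ->
  \sum_(c : {ffun T -> V} | [forall x, (x \notin A) ==> (c x == v0)] &&
      [forall x, forall y, e x y ==> (c x == c y)]) 1 =
  #|V| ^ n_comp e A.
Proof.
move=> sym_e cl_A; have sce := sym_connect_sym sym_e.
(* [U] represents the components inside [A]; [q] sends a point of [A] to the root of its component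
   and is [None] elsewhere. *)
pose U : finType := {x | (x \in roots e) && (x \in A)}.
pose q x : option U := insub (fingraph.root e x).
have rA x : (fingraph.root e x \in A) = (x \in A).
  by rewrite (closed_connect cl_A (connect_root e x)).
have rr x : fingraph.root e x \in roots e by exact: roots_root.
have qE x : q x = None -> x \notin A.
  by rewrite /q; case: insubP => //; rewrite rA rr.
have qS x u : q x = Some u -> x \in A /\ fingraph.root e x = val u.
  by rewrite /q; case: insubP => // w /andP[_]; rewrite rA => xA <- [<-].
have -> : #|V| ^ n_comp e A = \sum_(d : {ffun U -> V}) 1.
  rewrite sum1_card card_ffun card_sig.
  by congr (_ ^ _); apply: eq_card => x; rewrite !inE.
rewrite -(@sum_ffun_factor _ _ _ v0 q val (fun=> 1)) => [|u]; last first.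
  by rewrite /q; have /andP[/eqP -> _] := valP u; rewrite valK.
apply: eq_bigl => c; apply/andP/forallP => [[/forallP c0 /forallP ce] x|hc].
  case qx: (q x) => [u|] /=; last by have := c0 x; rewrite (qE _ qx).
  have [_ <-] := qS _ _ qx.
  have ce' y z : e y z -> c y = c z.
    by move=> yz; have /forallP/(_ z)/implyP/(_ yz)/eqP := ce y.
  have /connectP[r] := connect_root e x; move: (fingraph.root e x) => z.
  elim: r x {qx} => [|y r IH] x /= => [_ -> //|/andP[xy py] zE].
  by rewrite (ce' _ _ xy); apply: IH.
split; apply/forallP => x; first apply/implyP => xA.
  by rewrite (eqP (hc x)); case qx: (q x) => [u|] //; rewrite (qS _ _ qx).1 in xA.
apply/forallP => y; apply/implyP => xy.
by rewrite (eqP (hc x)) (eqP (hc y)) /q (fingraph.rootP sce (connect1 xy)).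
Qed.

(** * Powers of the number of components as counts of barbell colourings *)

Section barbell_coloring.
Variables (k : nat) (V : finType) (v0 : V).
Implicit Types (A B : {set 'I_k}) (P E : {set {set 'I_k}}).

Lemma card_barbell A B : B \in barbells A -> #|B| = 2.
Proof.
case/imset2P => x y xA; rewrite !inE => /andP[_ /andP[ox /eqP iy]] ->.
by rewrite cards2; case: eqVneq iy => // ->; lia.
Qed.

Lemma sub_barbell A B : B \in barbells A -> B \subset A.
Proof.
case/imset2P => x y xA; rewrite inE => /andP[yA _] ->.
by apply/subsetP => z; rewrite !inE => /orP[]/eqP->.
Qed.

Lemma mono_edges (c : 'I_k -> V) E : (forall B, B \in E -> #|B| = 2) ->
  mono c E = [forall x, forall y, ([set x; y] \in E) ==> (c x == c y)].
Proof.
move=> E2; apply/monoP/forallP => [h x|h B x y BE xB yB].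
  apply/forallP => y; apply/implyP => xyE; apply/eqP.
  by apply: (h _ x y xyE); rewrite !inE eqxx ?orbT.
have /eqP/cards2P[u [v [uv BE']]] := E2 _ BE.
have cuv : c u = c v by have /forallP/(_ v) := h u; rewrite -BE' BE => /eqP.
by move: xB yB; rewrite BE' !inE => /orP[]/eqP-> /orP[]/eqP->.
Qed.

(** Colourings constant along barbells and pairs are counted by components. Only the indicator
    [mono c P] depends on [P], which prepares the exchange of the sums over [c] and [P]. *)
Lemma expn_ncomp A S0 P0 P : pair_partition A P ->
  #|V| ^ barbell_ncomp (S0, A) (P0, P) =
  \sum_(c : {ffun 'I_k -> V} | [forall x, (x \notin A) ==> (c x == v0)] &&
      mono c (barbells A)) mono c P.
Proof.
move=> /andP[pP /'forall_implyP hP].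
have E2 B : B \in barbells A :|: P -> #|B| = 2.
  by rewrite inE => /orP[/card_barbell //|/hP/eqP].
rewrite /barbell_ncomp -(@sum_ffun_connect _ V v0); first last.
- apply: intro_closed => [|x y].
    by apply: sym_connect_sym => x y; rewrite /barbell_edge setUC.
  rewrite /barbell_edge /= inE => xyE _.
  suff /subsetP : [set x; y] \subset A by apply; rewrite !inE eqxx orbT.
  by case/orP: xyE => [/sub_barbell|/(partitionS pP)].
- by move=> x y; rewrite /barbell_edge setUC.
rewrite big_mkcondr /= [RHS]big_mkcondr /=; apply: eq_bigr => c _.
rewrite -mono_edges // monoU.
by case: (mono c (barbells A)); case: (mono c P).
Qed.

(* [None] outside [A]: there [index] returns the length of [enum A]. *)
Let half_index A (x : 'I_k) : option 'I_(#|A|./2) := insub (index x (enum A))./2.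

(** Barbell [j] joins positions [j.*2] and [j.*2.+1] of [enum A], counted from zero, and
    [half_index] maps both to [j]. As [#|A|] is even, the barbells cover [A], so the colourings are
    those of the set of barbells. *)
Lemma sum_mono_barbells A (F : {ffun 'I_k -> V} -> nat) : ~~ odd #|A| ->
  \sum_(c : {ffun 'I_k -> V} | [forall x, (x \notin A) ==> (c x == v0)] &&
      mono c (barbells A)) F c =
  \sum_(d : {ffun 'I_(#|A|./2) -> V})
     F [ffun x => oapp d v0 (half_index A x)].
Proof.
move=> oA; have ltm (j : 'I_(#|A|./2)) : j.*2 < #|A| by have := ltn_ord j; lia.
(* [s j] is the endpoint of barbell [j] at even position; it is a section of [half_index]. *)
pose s j := enum_val (Ordinal (ltm j)).
have indexs j : index (s j) (enum A) = j.*2.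
  by rewrite /s /enum_val index_uniq ?enum_uniq // -cardE.
have sA j : s j \in A by exact: enum_valP.
have hs j : half_index A (s j) = Some j.
  by rewrite /half_index indexs doubleK valK.
have hN x : x \notin A -> half_index A x = None.
  move=> xA; rewrite /half_index insubF //.
  have := index_size x (enum A).
  rewrite leq_eqVlt index_mem mem_enum (negbTE xA) orbF -cardE => /eqP ->.
  by rewrite ltnn.
have hA x : x \in A -> {j | half_index A x = Some j &
    index x (enum A) = odd (index x (enum A)) + j.*2}.
  move=> xA; have ix : index x (enum A) < #|A| by rewrite cardE index_mem mem_enum.
  have hx : (index x (enum A))./2 < #|A|./2 by lia.
  exists (Ordinal hx); rewrite ?odd_double_half //.
  by rewrite /half_index insubT.
rewrite -(sum_ffun_factor v0 _ hs); apply: eq_bigl => c.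
apply/andP/forallP => [[/forallP c0 /monoP cb] x|hc].
  have [xA|xA] := boolP (x \in A); last by have := c0 x; rewrite hN ?xA.
  have [j -> xE] /= := hA _ xA.
  have [ox|ex] := boolP (odd (index x (enum A))); last first.
    rewrite (negbTE ex) add0n -indexs in xE.
    by have -> : x = s j by apply: index_inj xE; rewrite ?mem_enum.
  rewrite (cb [set s j; x] x (s j)) ?set21 ?set22 //.
  apply/imset2P; exists (s j) x => //.
  by rewrite inE xA indexs odd_double xE ox add1n eqxx.
split; first by apply/forallP => x; apply/implyP => xA; rewrite (eqP (hc x)) hN.
apply/monoP => B x y /imset2P[u v uA]; rewrite inE => /and3P[vA eu /eqP iv ->].
suff cuv : c u = c v by rewrite !inE => /orP[]/eqP-> /orP[]/eqP->.
rewrite (eqP (hc u)) (eqP (hc v)); congr oapp.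
by rewrite /half_index iv -[in RHS]uphalfE uphalf_half (negbTE eu).
Qed.

(** Each barbell contributes its two endpoints: positions [j.*2] and [j.*2.+1] have the same
    half. *)
Lemma card_half_index_fiber A (d : {ffun 'I_(#|A|./2) -> V}) v : ~~ odd #|A| ->
  #|[set x in A | oapp d v0 (half_index A x) == v]| = #|fiber d v|.*2.
Proof.
move=> oA; rewrite -[LHS]sum1_card.
pose f i := oapp d v0 (insub i) == v : nat.
transitivity (\sum_(0 <= i < #|A|) f i./2).
  rewrite (eq_bigl (fun x => (x \in A) && (oapp d v0 (half_index A x) == v))); last first.
    by move=> x; rewrite inE.
  rewrite big_mkcondr -big_enum /=.
  case: (pickP (mem A)) => [x0 _|A0]; last first.
    have cA0 : #|A| = 0 by apply: eq_card0 => x; exact: A0.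
    have eA0 : enum A = [::] by apply: size0nil; rewrite -cardE.
    by rewrite eA0 big_nil big_geq // cA0.
  rewrite (big_nth x0) -cardE; apply: eq_big_nat => i /andP[_ iA].
  by rewrite /half_index index_uniq ?enum_uniq -?cardE // /f; case: (_ == v).
have double m : \sum_(0 <= i < m.*2) f i./2 = (\sum_(0 <= i < m) f i).*2.
  elim: m => [|m IH]; first by rewrite !big_geq.
  rewrite doubleS !big_nat_recr //= IH [in LHS]uphalf_double doubleK.
  by rewrite doubleD; lia.
rewrite -[in LHS](even_halfK oA) double; congr _.*2.
rewrite big_mkord -[in RHS]sum1_card [RHS]big_mkcond; apply: eq_bigr => j _.
by rewrite in_fiber /f valK; case: (_ == v).
Qed.

(** After exchanging sums, a fixed barbell colouring [d] leaves the monochromatic pair partitions of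
    [A] to count, for colour classes twice as large as the fibres of [d]. *)
Lemma sum_expn_ncomp A S0 P0 : ~~ odd #|A| ->
  \sum_(P | pair_partition A P) #|V| ^ barbell_ncomp (S0, A) (P0, P) =
  \sum_(d : {ffun 'I_(#|A|./2) -> V}) \prod_v matchings #|fiber d v|.*2.
Proof.
move=> oA.
rewrite (eq_bigr _ (fun P hP => expn_ncomp S0 P0 hP)) exchange_big /=.
rewrite sum_mono_barbells //; apply: eq_bigr => d _.
set c := [ffun x => _].
transitivity (\prod_v matchings #|[set x in A | c x == v]|); last first.
  apply: eq_bigr => v _; rewrite -(card_half_index_fiber d v oA).
  by congr matchings; apply: eq_card => x; rewrite !inE ffunE.
rewrite -sum_mono_partition [RHS]big_mkcondr /=; apply: eq_bigr => P _.
by case: (mono c P).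
Qed.

End barbell_coloring.

(** A barbell structure is given by [A], its second part, the first being the complement. The pairs
    in the complement do not affect the components and yield the factor [matchings #|~: A|].
    Positivity of [n] provides the default colour [ord0]. *)
Lemma barbell_sumE n k : 0 < n ->
  \sum_(beta : {set 'I_k} * {set 'I_k} | barbell_structure beta)
    \sum_(pi : {set {set 'I_k}} * {set {set 'I_k}} | barbell_pairing beta pi)
      n ^ barbell_ncomp beta pi =
  \sum_(A : {set 'I_k} | ~~ odd #|A| && ~~ odd #|~: A|)
    matchings #|~: A| *
    \sum_(d : {ffun 'I_(#|A|./2) -> 'I_n})
      \prod_v matchings #|fiber d v|.*2.
Proof.
case: n => // n _.
rewrite (reindex_onto (fun A => (~: A, A)) snd) /= => [|[S0 A]]; last first.
  rewrite /barbell_structure /= => /and3P[/eqP S0A dA _]; congr pair.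
  apply/setP => x; rewrite inE; have := in_setT x; rewrite -S0A inE.
  by case: (boolP (x \in S0)) => [xS|_ /= ->] //; rewrite (disjointFr dA xS).
apply: eq_big => [A|A /andP[/and3P[_ _ /andP[_ oA]] _]].
  rewrite /barbell_structure /= eqxx andbT setUC setUCr eqxx /=.
  by rewrite disjoint_sym disjoints_subset setCK subxx andTb andbC.
transitivity (\sum_(P0 | pair_partition (~: A) P0) \sum_(P | pair_partition A P)
    n.+1 ^ barbell_ncomp (~: A, A) (P0, P)).
  by rewrite pair_big; apply: eq_bigr => -[].
rewrite -sum_pair_partition big_distrl /=; apply: eq_bigr => P0 _.
by rewrite mul1n -{1}[n.+1]card_ord (sum_expn_ncomp ord0).
Qed.

(* Imported only here: all_classical shadows the notations of finset. *)
From mathcomp Require Import all_classical all_reals all_analysis.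
From mathcomp Require Import measurable_realfun.

Import Order.TTheory GRing.Theory Num.Theory.
Import numFieldNormedType.Exports.

Local Open Scope classical_set_scope.
Local Open Scope ring_scope.

(** * Moments of the one-dimensional Gaussian *)

Section gaussian_moments.
Context {R : realType}.
Local Notation mu := (@lebesgue_measure R).

Lemma integral_normal_fun s : s != 0 ->
  mu.-integrable setT (EFin \o normal_fun 0 s) /\
  (\int[mu]_x (normal_fun 0 s x)%:E = (normal_peak s)^-1%:E)%E.
Proof.
move=> s0; have p0 : normal_peak s != 0 by rewrite gt_eqF // normal_peak_gt0.
have ipdf := integrable_normal_pdf 0 s.
have fE : (fun x => (normal_fun 0 s x)%:E) =
    (fun x => ((normal_peak s)^-1%:E * (normal_pdf 0 s x)%:E)%E).
  by apply/funext => x /=; rewrite normal_pdfE // -EFinM mulKf.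
rewrite /comp fE; split; first exact: integrableZl.
by rewrite integralZl // integral_normal_pdf mule1.
Qed.

Definition gauss_weight (x : R) : R := expR (- (x ^+ 2 / 2)).

Lemma gauss_weightE : gauss_weight = normal_fun 0 1.
Proof. by apply/funext => x; rewrite /normal_fun subr0 expr1n mulNr. Qed.

(** Domination by a Gaussian of variance 2: [|x|^a <= exp (a|x|)], and [a|x| - x^2/2 <= a^2 - x^2/4]
    because [(|x|/2 - a)^2 >= 0]. *)
Lemma normr_expn_gauss_weight a x :
  `|x ^+ a * gauss_weight x| <= expR (a%:R ^+ 2) * normal_fun 0 (Num.sqrt 2) x.
Proof.
rewrite normrM [X in _ * X <= _]ger0_norm ?expR_ge0 // normrX.
have x_le : `|x| ^+ a <= expR (a%:R * `|x|).
  by rewrite expRM_natl lerXn2r ?nnegrE ?expR_ge0 //;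
    apply: le_trans (expR_ge1Dx _); rewrite lerDr.
apply: (@le_trans _ _ (expR (a%:R * `|x|) * gauss_weight x)).
  by rewrite ler_wpM2r ?expR_ge0.
rewrite /gauss_weight /normal_fun -!expRD ler_expR subr0 sqr_sqrtr //.
have := sqr_ge0 (`|x| / 2 - a%:R).
by rewrite -[x ^+ 2]real_normK ?num_real // => h; lra.
Qed.

Lemma measurable_expn_gauss_weight a :
  measurable_fun setT (fun x : R => x ^+ a * gauss_weight x).
Proof.
apply: measurable_funM; first exact: measurable_funX.
by rewrite gauss_weightE; exact: measurable_normal_fun.
Qed.

Lemma integrable_expn_gauss_weight a :
  mu.-integrable setT (fun x => (x ^+ a * gauss_weight x)%:E).
Proof.
have s0 : Num.sqrt 2 != 0 :> R by rewrite gt_eqF // sqrtr_gt0.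
have [iG _] := integral_normal_fun s0.
apply: (le_integrable _ _ _ (integrableZl measurableT (expR (a%:R ^+ 2)) iG)) => //.
  by apply/measurable_EFinP; exact: measurable_expn_gauss_weight.
move=> x _; rewrite /= lee_fin [leRHS]ger0_norm ?normr_expn_gauss_weight //.
by rewrite mulr_ge0 ?expR_ge0 // normal_fun_ge0.
Qed.

(* [h b] is the derivative of [F b]; integrating it over the line gives the
   recurrence between moments. *)
Let h b (x : R) := x ^+ b.+1 * gauss_weight x - b%:R * (x ^+ b.-1 * gauss_weight x).
Let F b (x : R) := - (x ^+ b * gauss_weight x).

Let is_derive_gauss_weight (x : R) :
  is_derive x 1 gauss_weight (- x * gauss_weight x).
Proof.
have dg : is_derive x 1 (fun y : R => - (y ^+ 2 / 2)) (- x).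
  by apply: is_derive_eq; rewrite /GRing.scale /= !mulr0; lra.
rewrite mulrC; exact: (@is_derive1_comp _ expR _ _ _ _ (is_derive_expR _) dg).
Qed.

Let is_derive_F b (x : R) : is_derive x 1 (F b) (h b x).
Proof.
have dw := is_derive_gauss_weight x.
have dX : is_derive x 1 (fun y : R => y ^+ b) (b%:R * x ^+ b.-1).
  have := is_deriveX b (is_derive_id x (1 : R)).
  by rewrite exprfctE /GRing.scale /= mulr1.
rewrite /F; apply: is_derive_eq; rewrite /h /GRing.scale /=.
by rewrite exprS; ring.
Qed.

Let measurable_h b : measurable_fun setT (h b).
Proof.
apply: measurable_funB; first exact: measurable_expn_gauss_weight.
by apply: measurable_funM => //; exact: measurable_expn_gauss_weight.
Qed.

Let integral_hE b :
  mu.-integrable setT (EFin \o h b) /\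
  (\int[mu]_x (h b x)%:E =
   \int[mu]_x (x ^+ b.+1 * gauss_weight x)%:E -
   b%:R%:E * \int[mu]_x (x ^+ b.-1 * gauss_weight x)%:E)%E.
Proof.
have i1 := integrable_expn_gauss_weight b.+1.
have i2 := integrable_expn_gauss_weight b.-1.
have i3 := integrableZl measurableT b%:R i2.
split; first exact: (integrableB measurableT i1 i3).
by rewrite -integralZl // -integralB.
Qed.

(** The sign [s] treats both ends of the line at once. Bounding the weighted power of exponent
    [b.+1] by [K] and dividing by the absolute value of the argument gives the decay. *)
Let cvg_F b (s : R) : s ^+ 2 = 1 -> F b (s * n.+1%:R) @[n --> \oo] --> (0 : R).
Proof.
move=> s2; pose K := expR (b.+1%:R ^+ 2) : R.
have Fb n : `|F b (s * n.+1%:R)| <= K * n.+1%:R^-1.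
  rewrite ler_pdivlMr // normrN.
  have sn : `|s| = 1 by apply/eqP; rewrite -sqrp_eq1 // -normrX s2 normr1.
  have := normr_expn_gauss_weight b.+1 (s * n.+1%:R).
  have -> : `|(s * n.+1%:R) ^+ b.+1 * gauss_weight (s * n.+1%:R)| =
      `|(s * n.+1%:R) ^+ b * gauss_weight (s * n.+1%:R)| * n.+1%:R.
    by rewrite exprS -mulrA normrM [`|s * _|]normrM sn mul1r ger0_norm // mulrC.
  move=> /le_trans; apply; rewrite ler_piMr ?expR_ge0 //.
  rewrite /normal_fun -expR0 ler_expR mulNr oppr_le0.
  by rewrite divr_ge0 ?sqr_ge0 // mulrn_wge0 // sqr_ge0.
have K0 : K * n.+1%:R^-1 @[n --> \oo] --> (0 : R).
  by rewrite -[X in _ --> X](mulr0 K); apply: cvgMr; exact: cvg_harmonic.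
apply: norm_cvg0; apply: squeeze_cvgr (cvg_cst 0) K0.
by near=> n; rewrite normr_ge0 Fb.
Unshelve. all: by end_near. Qed.

Let continuous_F b : continuous (F b).
Proof.
move=> x; apply/differentiable_continuous/derivable1_diffP.
by have [] := is_derive_F b x.
Qed.

Let continuous_h b : continuous (h b).
Proof.
have cw : continuous (gauss_weight : R -> R).
  move=> x; apply/differentiable_continuous/derivable1_diffP.
  by have [] := is_derive_gauss_weight x.
have cX a : continuous (fun x : R => x ^+ a).
  by move=> x; exact: exprn_continuous.
move=> x; apply: cvgB; first by apply: cvgM; [exact: cX|exact: cw].
by apply: cvgM; [exact: cvg_cst|apply: cvgM; [exact: cX|exact: cw]].
Qed.

Let integral_h_itv b n :
  (\int[mu]_(x in `[(- n.+1%:R)%R, (n.+1%:R : R)%R]) (h b x)%:E =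
   (F b n.+1%:R - F b (- n.+1%:R))%:E)%E.
Proof.
have ltn : - n.+1%:R < n.+1%:R :> R by rewrite gtrN.
rewrite (@continuous_FTC2 _ (h b) (F b)) //.
- exact/continuous_subspaceT/continuous_h.
- split.
  + by move=> x _; have [] := is_derive_F b x.
  + exact/cvg_at_right_filter/continuous_F.
  + exact/cvg_at_left_filter/continuous_F.
- by move=> x _; rewrite derive1E; have [_] := is_derive_F b x.
Qed.

(** Integrate over growing symmetric intervals: the boundary values of [F b] tend to zero, and
    dominated convergence applies with the absolute value of [h b] as bound. *)
Let integral_h b : (\int[mu]_x (h b x)%:E = 0)%E.
Proof.
have [ih _] := integral_hE b.
pose f n : R -> \bar R := (EFin \o h b) \_ `[(- n.+1%:R)%R, n.+1%:R%R].
have mh : measurable_fun (setT : set (measurableTypeR R)) (EFin \o h b).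
  by apply/measurable_EFinP; exact: measurable_h.
have [] := @dominated_convergence _ _ _ mu setT measurableT f (EFin \o h b)
  (abse \o (EFin \o h b)).
- move=> n; apply/(measurable_restrictT _ _).1 => //.
  exact: measurable_funTS.
- exact: mh.
- apply/aeW => x _; apply: cvg_near_cst.
  near=> n; rewrite /f patchE ifT //; rewrite inE /= in_itv /= -ler_norml.
  near: n; exists (Num.truncn `|x|) => // n /= xn.
  by apply/ltW/(lt_le_trans (truncnS_gt _)); rewrite ler_nat ltnS.
- exact: integrable_abse.
- apply/aeW => x n _; rewrite /f patchE /=; case: ifP => //.
  by rewrite abse0.
have -> : [sequence \int[mu]_x f n x]_n%E =
    fun n => (F b n.+1%:R - F b (- n.+1%:R))%:E.
  by apply/funext => n /=; rewrite /f -integral_mkcond integral_h_itv.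
move=> _ _ /cvg_unique; apply => //.
apply: cvg_EFin; first exact: nearW.
rewrite -[X in _ --> X](subr0 0); apply: cvgB.
  by under eq_cvg do rewrite -[_.+1%:R]mul1r; apply: cvg_F; rewrite expr1n.
by under eq_cvg do rewrite -mulN1r; apply: cvg_F; rewrite sqrrN expr1n.
Unshelve. all: by end_near. Qed.

Definition gauss_mass : R := (normal_peak 1)^-1.

Lemma gauss_mass_neq0 : gauss_mass != 0.
Proof. by rewrite invr_neq0 // gt_eqF // normal_peak_gt0 ?oner_neq0. Qed.

(** Integration by parts gives the moments the same recurrence as [matchings]. *)
Lemma integral_expn_gauss_weight a :
  (\int[mu]_x (x ^+ a * gauss_weight x)%:E = ((matchings a)%:R * gauss_mass)%:E)%E.
Proof.
(* For [b = 0] the truncated [b.-1] is harmless, its term having coefficient zero; this case gives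
   the vanishing first moment. *)
have rec b : (\int[mu]_x (x ^+ b.+1 * gauss_weight x)%:E =
    b%:R%:E * \int[mu]_x (x ^+ b.-1 * gauss_weight x)%:E)%E.
  have [_] := integral_hE b; rewrite integral_h => /esym/eqP.
  have f1 := integrable_fin_num measurableT (integrable_expn_gauss_weight b.+1).
  have f2 := integrable_fin_num measurableT (integrable_expn_gauss_weight b.-1).
  by rewrite sube_eq ?fin_num_adde_defl ?fin_numM // add0e => /eqP.
elim/ltn_ind: a => -[|[|a]] IH.
- rewrite mul1r; have [_ <-] := integral_normal_fun (oner_neq0 R).
  by apply: eq_integral => x _; rewrite mul1r gauss_weightE.
- by rewrite rec mul0e mul0r.
- by rewrite rec IH //= -EFinM mulrA -natrM.
Qed.

End gaussian_moments.

(** * Fubini for a product of functions of separate variables *)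

Section product_integral.
Context d1 d2 (T1 : measurableType d1) (T2 : measurableType d2) (R : realType).
Variables (m1 : {sigma_finite_measure set T1 -> \bar R})
  (m2 : {sigma_finite_measure set T2 -> \bar R}).
Variables (f1 : T1 -> R) (f2 : T2 -> R) (I1 I2 : R).
Hypotheses (if1 : m1.-integrable setT (EFin \o f1))
  (if2 : m2.-integrable setT (EFin \o f2)).

(** By Tonelli, the iterated integral of the absolute value is a product of two finite integrals. *)
Lemma integrable_prod_meas :
  (m1 \x m2)%E.-integrable setT (fun z => (f1 z.1 * f2 z.2)%:E).
Proof.
have /integrableP[/measurable_EFinP mf1 _] := if1.
have /integrableP[/measurable_EFinP mf2 _] := if2.
apply/integrable12ltyP => /=.
  apply/measurable_EFinP; apply: measurable_funM.
    exact: measurableT_comp.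
  exact: measurableT_comp.
have j1 := integrable_fin_num measurableT (integrable_abse if1).
have j2 := integrable_fin_num measurableT (integrable_abse if2).
under eq_integral => x _.
  under eq_integral do rewrite normrM EFinM.
  rewrite ge0_integralZl //; last first.
    by apply/measurable_EFinP; exact: measurableT_comp.
  over.
rewrite ge0_integralZr //; first by rewrite ltey_eq fin_numM.
- by apply/measurable_EFinP; exact: measurableT_comp.
- by apply: integral_ge0.
Qed.

Lemma integral_prod_meas : (\int[m1]_x (f1 x)%:E = I1%:E)%E ->
  (\int[m2]_x (f2 x)%:E = I2%:E)%E ->
  (\int[(m1 \x m2)%E]_z (f1 z.1 * f2 z.2)%:E = (I1 * I2)%:E)%E.
Proof.
move=> E1 E2; rewrite -integral12_prod_meas1; last exact: integrable_prod_meas.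
rewrite /fubini_F /=; under eq_integral => x _.
  under eq_integral do rewrite EFinM.
  by rewrite integralZl // E2 muleC; over.
by rewrite integralZl // E1 -EFinM mulrC.
Qed.

End product_integral.

(** * Integrals of coordinatewise products over tuples *)

Section tuple_integral.
Context {R : realType}.
Local Notation mR := (measurableTypeR R).

Lemma measurable_prod_tnth n (f : 'I_n -> mR -> R) :
  (forall i, measurable_fun setT (f i)) ->
  measurable_fun setT (fun t : n.-tuple mR => \prod_(i < n) f i (tnth t i)).
Proof.
move=> mf; apply: measurable_prod => i _; apply: measurableT_comp => //.
exact: measurable_tnth.
Qed.

(** [lebesgue_tuple] is the image of a product measure under [tuple_cons], so a change of variables
    and Fubini split off the first coordinate. The base case is a Dirac mass and an empty
    product. *)
Lemma integral_prod_tnth n (f : 'I_n -> mR -> R) (I : 'I_n -> R) :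
  (forall i, (@lebesgue_measure R).-integrable setT (EFin \o f i)) ->
  (forall i, (\int[@lebesgue_measure R]_x (f i x)%:E = (I i)%:E)%E) ->
  (@lebesgue_tuple R n).-integrable setT
    (fun t => (\prod_(i < n) f i (tnth t i))%:E) /\
  (\int[@lebesgue_tuple R n]_t (\prod_(i < n) f i (tnth t i))%:E =
    (\prod_(i < n) I i)%:E)%E.
Proof.
elim: n f I => [|n IH] f I intf intE.
  have -> : (fun t : 0.-tuple mR => (\prod_(i < 0) f i (tnth t i))%:E) = cst 1%E.
    by apply/funext => t; rewrite big_ord0.
  have d1 : (\int[@lebesgue_tuple R 0]_t cst 1 t = 1)%E.
    by rewrite integral_dirac //= diracE mem_set // mul1e.
  split; last by rewrite d1 big_ord0.
  apply/integrableP; split=> //.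
  by rewrite (eq_integral (cst 1%E)) ?d1 ?ltry // => t _; rewrite /= normr1.
have [iIH eIH] := IH (fun i => f (lift ord0 i)) (fun i => I (lift ord0 i))
  (fun i => intf _) (fun i => intE _).
have consE : (fun t : n.+1.-tuple mR => (\prod_(i < n.+1) f i (tnth t i))%:E)
    \o (@tuple_cons R n) =
    fun z => (f ord0 z.1 * \prod_(i < n) f (lift ord0 i) (tnth z.2 i))%:E.
  apply/funext => -[x t] /=; rewrite big_ord_recl tnth0; congr (_ * _)%:E.
  by apply: eq_bigr => i _; rewrite tnthS.
have iprod := integrable_prod_meas (intf ord0) iIH.
rewrite -consE in iprod.
have mcons : measurable_fun setT (@tuple_cons R n) by exact: measurable_cons.
have mf : measurable_fun setT
    (fun t : n.+1.-tuple mR => (\prod_(i < n.+1) f i (tnth t i))%:E).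
  apply/measurable_EFinP; apply: measurable_prod_tnth => i.
  by have /integrableP[/measurable_EFinP] := intf i.
split.
  exact: (integrable_pushforward mcons mf iprod measurableT).
rewrite big_ord_recl -(integral_prod_meas (intf ord0) iIH) //.
rewrite -consE; exact: (integral_pushforward mcons mf iprod measurableT).
Qed.

End tuple_integral.

(** * Expansion of the trace of a power and its Gaussian mean *)

Section spin_trace.
Context {R : realType} {n : nat}.
Local Notation mR := (measurableTypeR R).
Local Notation spin := (mR * n.-tuple mR)%type.

Let radius (x : spin) : R := Num.sqrt (dotp x.2 x.2).

Let radiusK x : radius x ^+ 2 = dotp x.2 x.2.
Proof. by rewrite sqr_sqrtr // sumr_ge0 // => i _; rewrite -expr2 sqr_ge0. Qed.

(* The spectral values of [x] are [x.1 +- radius x]. *)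
Let spin_exp_spec (x : spin) k : exists b : R,
  [/\ forall i, tnth (spin_exp x k).2 i = b * tnth x.2 i :> R,
      b * radius x = ((x.1 + radius x) ^+ k - (x.1 - radius x) ^+ k) / 2 &
      spin_tr (spin_exp x k) = ((x.1 + radius x) ^+ k + (x.1 - radius x) ^+ k) / 2].
Proof.
case: k => [|k].
  exists 0; split=> [i||]; first by rewrite tnth_mktuple mul0r.
    by rewrite !expr0 subrr !mul0r.
  by rewrite /spin_tr /= !expr0; lra.
elim: k => [|k [b [xb bE aE]]].
  by exists 1; split=> [i||]; rewrite ?mul1r ?expr1 /spin_tr /=; lra.
have -> : spin_exp x k.+2 = spin_mul x (spin_exp x k.+1) by [].
move: xb aE; rewrite /spin_tr; case: (spin_exp x k.+1) => a y /= xb aE.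
(* If the previous power is [(a, b x)], the vector part of the next is [(x_0 b + a) x]. The
   invariant concerns [b * radius x], not a quotient, since the radius may vanish. *)
exists (x.1 * b + a); split=> [i||].
- by rewrite tnth_mktuple xb /=; ring.
- by rewrite mulrDl -mulrA bE aE ![_ ^+ k.+2]exprS; field.
- have -> : dotp x.2 y = b * radius x * radius x.
    rewrite -mulrA -expr2 radiusK /dotp mulr_sumr; apply: eq_bigr => i _.
    by rewrite xb; ring.
  by rewrite bE aE ![_ ^+ k.+2]exprS; field.
Qed.

(** Binomial expansion before grouping by size: [A] is the set of factors that contribute [b]. *)
Lemma exprD_sum_subsets (a b : R) k :
  (a + b) ^+ k = \sum_(A : {set 'I_k}) a ^+ #|~: A| * b ^+ #|A|.
Proof.
rewrite -[in LHS](card_ord k) -prodr_const.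
rewrite (eq_bigl xpredT) // (eq_bigr (fun=> b + a)) => [|i _]; last exact: addrC.
rewrite bigA_distr; apply: eq_bigr => A _.
rewrite (bigID (mem A)) /= mulrC; congr (_ * _).
  rewrite -prodr_const; apply: eq_big => [i|i /negbTE -> //].
  by rewrite inE.
by rewrite -prodr_const; apply: eq_bigr => i ->.
Qed.

(** Multinomial expansion before grouping: [d] records which summand each of the [m] factors
    contributes. *)
Lemma expr_sum_ffun (t : 'I_n -> R) m :
  (\sum_i t i ^+ 2) ^+ m =
  \sum_(d : {ffun 'I_m -> 'I_n}) \prod_v t v ^+ #|fiber d v|.*2.
Proof.
rewrite -[in LHS](card_ord m) -prodr_const bigA_distr_bigA /=.
apply: eq_bigr => d _; rewrite (partition_big d xpredT) //=.
apply: eq_bigr => v _; rewrite -mul2n exprM -prodr_const.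
by apply: eq_big => [j|j /eqP -> //]; rewrite in_fiber.
Qed.

(** In the half-sum of the powers of the two spectral values, subsets of odd size cancel. Those of
    even size carry an even power of the radius, hence a polynomial in the coordinates. *)
Lemma spin_tr_exp (x : spin) k : spin_tr (spin_exp x k) =
  \sum_(A : {set 'I_k} | ~~ odd #|A|)
    \sum_(d : {ffun 'I_(#|A|./2) -> 'I_n})
      (x.1 : R) ^+ #|~: A| * \prod_v (tnth x.2 v : R) ^+ #|fiber d v|.*2.
Proof.
have [b [_ _ ->]] := spin_exp_spec x k.
rewrite !exprD_sum_subsets -big_split mulr_suml [RHS]big_mkcond /=.
apply: eq_bigr => A _; rewrite -mulrDr -mulr_sumr -expr_sum_ffun.
have -> : \sum_i (tnth x.2 i : R) ^+ 2 = radius x ^+ 2.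
  by rewrite radiusK; apply: eq_bigr => i _; rewrite expr2.
rewrite -exprM exprNn -signr_odd mul2n; case: ifPn => oA.
  by rewrite even_halfK // (negbTE oA) expr0; lra.
by rewrite (negbNE oA) expr1; lra.
Qed.

Lemma spin_weightE (x : spin) :
  spin_weight x = gauss_weight x.1 * \prod_v gauss_weight (tnth x.2 v).
Proof.
rewrite /spin_weight /gauss_weight -expR_sum -expRD; congr expR.
rewrite /spin_tr /= /dotp sumrN -mulr_suml; under [in RHS]eq_bigr do rewrite expr2.
by lra.
Qed.

(** Monomial and weight both factor over the [n.+1] coordinates, so one-dimensional moments
    multiply. *)
Lemma integral_monomial_spin_weight a (e : 'I_n -> nat) :
  (@spin_measure R n).-integrable setT
    (fun x => ((x.1 : R) ^+ a * \prod_v (tnth x.2 v : R) ^+ e v * spin_weight x)%:E) /\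
  (\int[@spin_measure R n]_x
     ((x.1 : R) ^+ a * \prod_v (tnth x.2 v : R) ^+ e v * spin_weight x)%:E =
   ((matchings a * \prod_v matchings (e v))%:R * gauss_mass ^+ n.+1)%:E)%E.
Proof.
pose f0 (x : mR) : R := x ^+ a * gauss_weight x.
pose f (v : 'I_n) (x : mR) : R := x ^+ e v * gauss_weight x.
have fE : (fun x : spin => ((x.1 : R) ^+ a * \prod_v (tnth x.2 v : R) ^+ e v *
    spin_weight x)%:E) = fun x => (f0 x.1 * \prod_v f v (tnth x.2 v))%:E.
  by apply/funext => x; rewrite spin_weightE big_split mulrACA.
have [ip ipE] := @integral_prod_tnth R n f (fun v => (matchings (e v))%:R * gauss_mass)
  (fun v => integrable_expn_gauss_weight (e v))
  (fun v => integral_expn_gauss_weight (e v)).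
have i0 := @integrable_expn_gauss_weight R a.
rewrite fE; split; first exact: (integrable_prod_meas i0 ip).
rewrite (integral_prod_meas i0 ip (integral_expn_gauss_weight a) ipE).
rewrite big_split /= prodr_const card_ord natrM natr_prod exprS.
by congr (_%:E); ring.
Qed.

Lemma spin_mean_tr_exp k :
  @spin_mean R n (fun x => spin_tr (spin_exp x k)) =
  ((\sum_(A : {set 'I_k} | ~~ odd #|A|)
    matchings #|~: A| *
    \sum_(d : {ffun 'I_(#|A|./2) -> 'I_n})
      \prod_v matchings #|fiber d v|.*2)%N%:R)%:E.
Proof.
set S : nat := (\sum_(A | _) _)%N.
(* The denominator is the integral of the monomial with all exponents zero. *)
have den : (\int[@spin_measure R n]_x (spin_weight x)%:E = (gauss_mass ^+ n.+1)%:E)%E.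
  have [_] := integral_monomial_spin_weight 0 (fun=> 0%N).
  rewrite big1 // mul1r => <-; apply: eq_integral => x _.
  by rewrite big1 // !mul1r.
have num : (\int[@spin_measure R n]_x
    (spin_tr (spin_exp x k) * spin_weight x)%:E = (S%:R * gauss_mass ^+ n.+1)%:E)%E.
  under eq_integral => x _.
    rewrite spin_tr_exp mulr_suml -sumEFin.
    under eq_bigr => A _ do rewrite mulr_suml -sumEFin.
    over.
  rewrite integral_sum // => [|A]; last first.
    by apply: integrable_sum => // d _; have [] := integral_monomial_spin_weight #|~: A|
      (fun v => #|fiber d v|.*2).
  rewrite natr_sum mulr_suml -sumEFin; apply: eq_bigr => A _.
  rewrite integral_sum // => [|d]; last first.
    by have [] := integral_monomial_spin_weight #|~: A| (fun v => #|fiber d v|.*2).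
  rewrite big_distrr /= natr_sum mulr_suml -sumEFin; apply: eq_bigr => d _.
  by have [_ ->] := integral_monomial_spin_weight #|~: A| (fun v => #|fiber d v|.*2).
rewrite /spin_mean num den inver expf_eq0 (negbTE gauss_mass_neq0) andbF.
by rewrite -EFinM mulfK // expf_neq0 // gauss_mass_neq0.
Qed.

End spin_trace.

(** * Comparison of the analytic and combinatorial sums *)

Theorem theorem6p4 (R : realType) (n k : nat) (hn : (1 <= n)%N) :
  (odd k ->
    @spin_mean R n (fun x => spin_tr (spin_exp x k)) = 0%E) /\
  (~~ odd k ->
    @spin_mean R n (fun x => spin_tr (spin_exp x k)) =
    (\sum_(beta : {set 'I_k} * {set 'I_k} | barbell_structure beta)
      \sum_(pi : {set {set 'I_k}} * {set {set 'I_k}} | barbell_pairing beta pi)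
        n%:R ^+ barbell_ncomp beta pi)%:E).
Proof.
rewrite spin_mean_tr_exp; split=> [ok|ek].
  (* For odd [k], an even subset has an odd complement, which has no perfect matching. *)
  rewrite big1 // => A oA; rewrite matchings_odd //.
  by rewrite odd_cardsC ok (negbTE oA).
congr (_%:E); transitivity
    ((\sum_(beta : {set 'I_k} * {set 'I_k} | barbell_structure beta)
      \sum_(pi : {set {set 'I_k}} * {set {set 'I_k}} | barbell_pairing beta pi)
        n ^ barbell_ncomp beta pi)%N%:R : R); last first.
  rewrite natr_sum; apply: eq_bigr => beta _.
  by rewrite natr_sum; apply: eq_bigr => pi _; rewrite natrX.
(* For even [k], the complement of an even subset is even, so both sums range over the same
   subsets. *)
congr (_%:R); rewrite barbell_sumE //; apply: eq_bigl => A.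
by rewrite odd_cardsC (negbTE ek) addFb andbb.
Qed.
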